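(* Let $\mathcal{E}$ be a nilpotent evolution algebra of type $[1,1,2,1]$ over an algebraically closed field $\mathbb{F}$ of characteristic not two, and fix $i\in\mathbb{F}$ with $i^2=-1$. Then $\mathcal{E}$ is isomorphic to one of the following evolution algebras, given by the squares of the elements of a natural basis $\{e_1,\ldots,e_5\}$ (products $e_je_k$ with $j\neq k$ are $0$), where in all cases $e_2^2=e_4$, $e_4^2=e_5$, $e_5^2=0$, and: - (1) $e_1^2=e_2$, $e_3^2=e_4$; - (2) $e_1^2=e_2+e_4$, $e_3^2=e_4$; - (3) $e_1^2=e_2+i\,e_3$, $e_3^2=e_4$; - (4) $e_1^2=e_2+i\,e_3+e_4$, $e_3^2=e_4$; - (5) $e_1^2=e_2+\alpha e_4$, $e_3^2=e_4+e_5$, with $\alpha\in\mathbb{F}$; - (6) $e_1^2=\beta e_2+e_3+\gamma e_4$, $e_3^2=e_4+e_5$, with $\beta,\gamma\in\mathbb{F}$, $\beta\neq0$. Algebras in different families among (1)–(6) are not isomorphic. Two algebras in family (5) with parameters $\alpha,\alpha'$ are isomorphic if and only if $\alpha'=\alpha$ or $\alpha'=-\alpha$. Two algebras in family (6) with parameters $(\beta,\gamma)$ and $(\beta',\gamma')$ are isomorphic if and only if either $\beta'\in\{\beta,-\beta\}$ and $\gamma'\in\{\gamma,-\gamma\}$, or $\beta\beta'\in\{1,-1\}$ and $\gamma'\in\{i\beta^{-1}\gamma,-i\beta^{-1}\gamma\}$.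
   Context: An evolution algebra (finite-dimensional here) is an algebra $\mathcal{E}$ over $\mathbb{F}$ with a basis $\{e_1,\ldots,e_n\}$ (a natural basis) such that $e_je_k=0$ for $j\neq k$; it is automatically commutative, and need not be associative. For an algebra $\mathcal{A}$, $\mathrm{ann}(\mathcal{A})=\{x\in\mathcal{A}: x\mathcal{A}=\mathcal{A}x=0\}$, $\mathrm{ann}^0(\mathcal{A})=0$, and $\mathrm{ann}^j(\mathcal{A})$ is defined by $\mathrm{ann}^j(\mathcal{A})/\mathrm{ann}^{j-1}(\mathcal{A})=\mathrm{ann}(\mathcal{A}/\mathrm{ann}^{j-1}(\mathcal{A}))$. With $\mathcal{A}^1=\mathcal{A}$ and $\mathcal{A}^{k+1}=\sum_{j=1}^k\mathcal{A}^j\mathcal{A}^{k+1-j}$, $\mathcal{A}$ is nilpotent if $\mathcal{A}^m=0$ for some $m$, equivalently $\mathrm{ann}^r(\mathcal{A})=\mathcal{A}$ for some $r$. The type of a finite-dimensional nilpotent algebra $\mathcal{A}$ is the sequence $[n_1,\ldots,n_r]$, where $r$ is the least natural number with $\mathrm{ann}^r(\mathcal{A})=\mathcal{A}$ and $n_j=\dim\mathrm{ann}^j(\mathcal{A})-\dim\mathrm{ann}^{j-1}(\mathcal{A})$. *)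

(* Defs.v *)
From HB Require Import structures.
From mathcomp Require Import all_boot all_order all_algebra.

Set Implicit Arguments.
Unset Strict Implicit.
Unset Printing Implicit Defensive.

Import GRing.Theory.
Local Open Scope ring_scope.

(* Finite-dimensional algebras: the product is only required to be bilinear,
   with no associativity, commutativity or unit. *)
Record algebra (F : fieldType) := MkAlgebra {
  carrier :> vectType F;
  amul : {bilinear carrier -> carrier -> carrier}
}.

Arguments amul {F A} : rename.

Definition isomorphic (F : fieldType) (A B : algebra F) : Prop :=
  exists f : 'Hom(A, B),
    bijective f /\ forall x y : A, f (amul x y) = amul (f x) (f y).

Section AlgebraTheory.
Variables (F : fieldType) (A : algebra F).
Implicit Types (U V W : {vspace A}) (x y : A).

Definition natural_basis n (e : n.-tuple A) : Prop :=
  basis_of fullv e /\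
  forall j k : 'I_n, j != k -> amul (tnth e j) (tnth e k) = 0.

Definition evolution_algebra : Prop :=
  exists n, exists e : n.-tuple A, natural_basis e.

Definition prodv U V : {vspace A} :=
  <<[seq amul x y | x <- vbasis U, y <- vbasis V]>>%VS.

Lemma memv_mul U V x y : x \in U -> y \in V -> amul x y \in prodv U V.
Proof.
move=> Ux Vy; rewrite (coord_vbasis Ux) (coord_vbasis Vy) linear_sumlz /=.
apply: memv_suml => j _; rewrite linear_sum /=.
apply: memv_suml => k _; rewrite linearZl_LR linearZr /= !memvZ // memv_span //.
by apply/allpairsP; exists ((vbasis U)`_j, (vbasis V)`_k); rewrite !memt_nth.
Qed.

Lemma prodvP U V W :
  reflect (forall x y, x \in U -> y \in V -> amul x y \in W)
          (prodv U V <= W)%VS.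
Proof.
apply: (iffP idP) => [sUVW x y Ux Vy | sUVW].
  by apply: subvP sUVW _ _; apply: memv_mul.
apply/span_subvP => _ /allpairsP[[x y] /= [Ux Vy ->]].
by apply: sUVW; apply: vbasis_mem.
Qed.

(* The list [:: A^1; ...; A^n]; entry j of the list is A^(j+1). *)
Fixpoint power_seq n : seq {vspace A} :=
  if n is m.+1 then
    let s := power_seq m in
    rcons s (if m is 0 then fullv
             else (\sum_(j < m) prodv (nth 0 s j) (nth 0 s (m - j.+1)))%VS)
  else [::].

(* The power A^k for 0 < k; the value at k = 0 is junk. *)
Definition power k : {vspace A} := nth 0%VS (power_seq k) k.-1.

Lemma size_power_seq n : size (power_seq n) = n.
Proof. by elim: n => //= n IHn; rewrite size_rcons IHn. Qed.

Lemma nth_power_seq n j : (j < n)%N -> nth 0%VS (power_seq n) j = power j.+1.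
Proof.
elim: n => // n IHn; rewrite ltnS leq_eqVlt => /predU1P[-> // | lt_jn].
by rewrite /= nth_rcons size_power_seq lt_jn IHn.
Qed.

Lemma power1 : power 1 = fullv.
Proof. by []. Qed.

Lemma powerS k : (0 < k)%N ->
  power k.+1 = (\sum_(1 <= j < k.+1) prodv (power j) (power (k.+1 - j)))%VS.
Proof.
case: k => // k _; rewrite big_add1 big_mkord [LHS]/power.
rewrite -[power_seq k.+2]/(rcons (power_seq k.+1) _).
rewrite nth_rcons size_power_seq ltnn eqxx; apply: eq_bigr => j _.
rewrite -[LHS]/(prodv (nth 0%VS (power_seq k.+1) j)
                      (nth 0%VS (power_seq k.+1) (k.+1 - j.+1))).
have le_jk : (j <= k)%N by rewrite -ltnS.
by rewrite !nth_power_seq ?subSS ?ltnS ?leq_subr // subSn.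
Qed.

Definition nilpotent : Prop := exists2 m, (0 < m)%N & power m = 0%VS.

(* The subspace {x | x A <= U and A x <= U}, computed on a basis of A. When U is
   an ideal this is the inverse image of ann (A / U), see ann_mod_quotient. *)
Definition ann_mod U : {vspace A} :=
  (\bigcap_(y <- vbasis (fullv : {vspace A}))
     (linfun (applyr amul y) @^-1: U :&: linfun (amul y) @^-1: U))%VS.

Lemma ann_modP U x :
  reflect (forall y, amul x y \in U /\ amul y x \in U) (x \in ann_mod U).
Proof.
have memE : (x \in ann_mod U) =
    all (fun y => (amul x y \in U) && (amul y x \in U))
        (vbasis (fullv : {vspace A})).
  rewrite /ann_mod; elim: (tval _) => [|y s IHs]; first by rewrite big_nil memvf.
  by rewrite big_cons memv_cap IHs /= memv_cap -!memv_preim !lfunE.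
rewrite memE; apply: (iffP allP) => [Ux y | Ux y _]; last exact/andP/Ux.
have Ub k : amul x (vbasis fullv)`_k \in U /\ amul (vbasis fullv)`_k x \in U.
  have [lt_k | le_k] := ltnP k (size (vbasis (fullv : {vspace A}))).
    by apply/andP/Ux/mem_nth.
  by rewrite nth_default // linear0r linear0l mem0v.
rewrite (coord_vbasis (memvf y)) linear_sumr linear_sumlz /=.
by split; apply: memv_suml => k _; rewrite ?linearZr ?linearZl_LR memvZ //;
  have [] := Ub k.
Qed.

Definition ann : {vspace A} := ann_mod 0%VS.

Fixpoint ann_iter j : {vspace A} :=
  if j is j'.+1 then ann_mod (ann_iter j') else 0%VS.

Definition has_type (s : seq nat) : Prop :=
  exists r, [/\ ann_iter r = fullv,
                forall r', ann_iter r' = fullv -> (r <= r')%N &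
                s = [seq (\dim (ann_iter j) - \dim (ann_iter j.-1))%N
                    | j <- iota 1 r]].

End AlgebraTheory.

Lemma ann_mod_quotient (F : fieldType) (A B : algebra F) (f : 'Hom(A, B)) :
    (forall x y : A, f (amul x y) = amul (f x) (f y)) -> limg f = fullv ->
  ann_mod (lker f) = (f @^-1: ann B)%VS.
Proof.
move=> fM fsurj; apply/vspaceP => x; rewrite -memv_preim.
apply/ann_modP/ann_modP => [fx z | fx y].
  have /memv_imgP[y _ ->] : z \in limg f by rewrite fsurj memvf.
  by rewrite -!fM !memv0 -!memv_ker.
by have := fx (f y); rewrite -!fM !memv0 -!memv_ker.
Qed.

(* The evolution algebra F^n whose natural basis is the canonical basis
   (delta_mx 0 j)_j, the square of the j-th basis vector being tnth sq j. *)
Section EvolutionAlgebra.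
Variables (F : fieldType) (n : nat) (sq : n.-tuple 'rV[F]_n).

Definition evo_mul (x y : 'rV[F]_n) : 'rV[F]_n :=
  \sum_(j < n) (x 0 j * y 0 j) *: tnth sq j.

Fact evo_mul_bilinear : bilinear_for *:%R *:%R evo_mul.
Proof.
split=> z a x y; rewrite /= /evo_mul scaler_sumr -big_split /=;
  apply: eq_bigr => j _; rewrite !mxE scalerA -scalerDl; congr (_ *: _).
  by rewrite mulrDl mulrA.
by rewrite mulrDr mulrCA.
Qed.

HB.instance Definition _ :=
  bilinear_isBilinear.Build F 'rV[F]_n 'rV[F]_n 'rV[F]_n *:%R *:%R evo_mul
    evo_mul_bilinear.

Definition evo_algebra : algebra F :=
  @MkAlgebra F 'rV[F]_n (evo_mul : {bilinear _ -> _ -> _}).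

Lemma evo_mul_delta (j k : 'I_n) :
  evo_mul (delta_mx 0 j) (delta_mx 0 k) = if j == k then tnth sq j else 0.
Proof.
rewrite /evo_mul (bigD1 j) //= big1 => [|l ne_lj].
  by rewrite !mxE !eqxx mul1r addr0; case: eqP; rewrite ?scale1r ?scale0r.
by rewrite !mxE (negPf ne_lj) andbF mul0r scale0r.
Qed.

End EvolutionAlgebra.

Section Families.
Variables (F : fieldType) (i : F).

(* basis m is the natural basis vector e_m, 1 <= m <= 5. *)
Local Notation basis m := (delta_mx 0 (inord m.-1) : 'rV[F]_5).
Local Notation e2 := (basis 2).
Local Notation e3 := (basis 3).
Local Notation e4 := (basis 4).
Local Notation e5 := (basis 5).

(* The common pattern: e2^2 = e4, e4^2 = e5, e5^2 = 0; the arguments are e1^2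
   and e3^2. *)
Definition evo5 (sq1 sq3 : 'rV[F]_5) : algebra F :=
  evo_algebra [tuple sq1; e4; sq3; e5; 0].

Definition E1 := evo5 e2 e4.
Definition E2 := evo5 (e2 + e4) e4.
Definition E3 := evo5 (e2 + i *: e3) e4.
Definition E4 := evo5 (e2 + i *: e3 + e4) e4.
Definition E5 (alpha : F) := evo5 (e2 + alpha *: e4) (e4 + e5).
Definition E6 (beta gamma : F) :=
  evo5 (beta *: e2 + e3 + gamma *: e4) (e4 + e5).

Inductive evo_family : nat -> algebra F -> Prop :=
| Family1 : evo_family 1 E1
| Family2 : evo_family 2 E2
| Family3 : evo_family 3 E3
| Family4 : evo_family 4 E4
| Family5 alpha : evo_family 5 (E5 alpha)
| Family6 beta gamma of beta != 0 : evo_family 6 (E6 beta gamma).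

End Families.

(* Main.v *)
From HB Require Import structures.
Require Import Defs.
From mathcomp Require Import all_boot all_order all_algebra.
From mathcomp Require Import ring zify.
Set Implicit Arguments.
Unset Strict Implicit.
Unset Printing Implicit Defensive.
Import GRing.Theory.
Local Open Scope ring_scope.

(* In an evolution algebra every ann^j is spanned by vectors of the natural
   basis. Type [1,1,2,1] therefore orders the basis so that e1^2 lies in
   <e2, ..., e5>, e2^2 and e3^2 in <e4, e5>, e4^2 in <e5> and e5^2 = 0. Replacing
   e4 by e2^2 and e5 by e4^2, scaling e3, and absorbing the e5-part of e1^2 into
   e2 or e3 leaves e1^2 = a2 e2 + a3 e3 + a4 e4, e2^2 = e4, e3^2 = e4 + d e5,
   e4^2 = e5.
   An isomorphism between two such algebras preserves the annihilator series,
   hence reduces to e1 |-> r e1 and a similitude of the form x^2 + y^2 on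
   <e2, e3>. For d = 0 every similitude is allowed, and the orbits of
   (a2, a3, a4) depend only on whether (a2, a3) is isotropic and whether a4 = 0:
   families (1)-(4). For d != 0 only scalings of the axes <e2>, <e3> and their
   exchange remain: families (5) and (6). *)

(** * Isomorphism of algebras as an equivalence relation *)

Section Isomorphisms.
Variable F : fieldType.

Lemma isomorphicI (A B : algebra F) (g : A -> B) :
    linear g -> bijective g -> (forall x y, g (amul x y) = amul (g x) (g y)) ->
  isomorphic A B.
Proof.
move=> g_lin g_bij gM.
pose gL := GRing.isLinear.Build F A B *:%R g g_lin.
pose h : {linear A -> B} := HB.pack g gL.
have hE : linfun h =1 g by move=> x; rewrite lfunE.
exists (linfun h); split; first exact: eq_bij g_bij _ (fsym hE).
by move=> x y; rewrite !hE gM.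
Qed.

Lemma isomorphic_trans (A B C : algebra F) :
  isomorphic A B -> isomorphic B C -> isomorphic A C.
Proof.
move=> [f [f_bij fM]] [g [g_bij gM]]; apply: (@isomorphicI _ _ (g \o f)).
- by move=> a x y; rewrite /= !linearP.
- exact: bij_comp.
- by move=> x y; rewrite /= fM gM.
Qed.

Lemma isomorphic_sym (A B : algebra F) : isomorphic A B -> isomorphic B A.
Proof.
move=> [f [[g fK gK] fM]]; apply: (@isomorphicI _ _ g).
- by move=> a x y; apply: (can_inj fK); rewrite gK linearP /= !gK.
- by exists f.
- by move=> x y; apply: (can_inj fK); rewrite fM !gK.
Qed.

End Isomorphisms.

(** * Annihilators computed in a natural basis *)

Section NaturalBasis.
Variables (F : fieldType) (A : algebra F) (n : nat) (e : n.-tuple A).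
Hypothesis e_nat : natural_basis e.
Implicit Type U : {vspace A}.

Lemma natural_coordE x : x = \sum_j coord e j x *: tnth e j.
Proof.
rewrite {1}(coord_basis e_nat.1 (memvf x)).
by apply: eq_bigr => j _; rewrite (tnth_nth 0).
Qed.

Lemma natural_mulE x y :
  amul x y = \sum_j (coord e j x * coord e j y) *: amul (tnth e j) (tnth e j).
Proof.
rewrite {1}(natural_coordE x) {1}(natural_coordE y) linear_sumlz /=.
apply: eq_bigr => j _; rewrite linear_sum /= (bigD1 j) //= big1 => [|l ne_lj].
  by rewrite addr0 linearZl_LR linearZr /= scalerA.
by rewrite linearZl_LR linearZr /= e_nat.2 1?eq_sym // !scaler0.
Qed.

Lemma natural_coord_tnth k j : coord e k (tnth e j) = (k == j)%:R.
Proof. by rewrite (tnth_nth 0) coord_free ?(basis_free e_nat.1) // eq_sym. Qed.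

(** Multiplying x by the basis vector e_j isolates x_j e_j^2, so x only sees the squares e_j^2 with
    x_j nonzero, and these squares generate all products with x. *)
Lemma natural_ann_modP U x :
  reflect (forall j, coord e j x != 0 -> amul (tnth e j) (tnth e j) \in U)
          (x \in ann_mod U).
Proof.
apply: (iffP (ann_modP U x)) => [xU j xj0 | xU y].
  have [] := xU (tnth e j); rewrite natural_mulE (bigD1 j) //= big1 => [|l ne_lj].
    by rewrite addr0 natural_coord_tnth eqxx mulr1 rpredZeq (negPf xj0).
  by rewrite natural_coord_tnth (negPf ne_lj) mulr0 scale0r.
rewrite !natural_mulE; split; apply: memv_suml => j _;
  by have [-> | /xU Uj] := eqVneq (coord e j x) 0;
    rewrite ?mulr0 ?mul0r ?scale0r ?mem0v // memvZ.
Qed.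

Lemma natural_ann_mod_tnth U j :
  (tnth e j \in ann_mod U) = (amul (tnth e j) (tnth e j) \in U).
Proof.
apply/natural_ann_modP/idP => [-> // | Uj k]; rewrite natural_coord_tnth.
  by rewrite eqxx oner_neq0.
by have [-> // | _] := eqVneq k j; rewrite eqxx.
Qed.

Lemma natural_ann_mod_coord U x j :
  x \in ann_mod U -> tnth e j \notin ann_mod U -> coord e j x = 0.
Proof.
move=> /natural_ann_modP xU; rewrite natural_ann_mod_tnth => Uj.
by apply: contraNeq Uj => /xU.
Qed.

(** An element of [ann_mod U] has zero coordinate on every basis vector outside [ann_mod U], so this
    subspace is spanned by the basis vectors that it contains. Counting them turns the type of an
    algebra into a partition of its natural basis. *)
Lemma dim_natural_ann_mod U : \dim (ann_mod U) = count [in ann_mod U] e.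
Proof.
have e_free := basis_free e_nat.1.
suff annE : ann_mod U = <<filter [in ann_mod U] e>>%VS.
  by rewrite {1}annE -size_filter; apply/eqP/filter_free.
apply/eqP; rewrite eqEsubv; apply/andP; split; last first.
  by apply/span_subvP => x; rewrite mem_filter => /andP[].
apply/subvP => x xU; rewrite (natural_coordE x); apply: memv_suml => j _.
have [Uj | /(natural_ann_mod_coord xU) ->] := boolP (tnth e j \in ann_mod U).
  by rewrite memvZ // memv_span // mem_filter mem_tnth andbT.
by rewrite scale0r mem0v.
Qed.

(** The isomorphism is the coordinate map of the natural basis. *)
Lemma natural_basis_isomorphic :
  isomorphic A (evo_algebra
    [tuple \row_k coord e k (amul (tnth e j) (tnth e j)) | j < n]).
Proof.
apply: (@isomorphicI _ _ (evo_algebra _) (fun x => \row_k coord e k x)).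
- by move=> a x y; apply/rowP => k; rewrite !mxE linearP.
- exists (fun r : 'rV_n => \sum_j r 0 j *: tnth e j) => [x | r].
    by rewrite [RHS]natural_coordE; apply: eq_bigr => j _; rewrite mxE.
  apply/rowP => k; rewrite mxE linear_sum (bigD1 k) //= big1 => [|j ne_jk].
    by rewrite linearZ /= natural_coord_tnth eqxx addr0 mulr1.
  by rewrite linearZ /= natural_coord_tnth eq_sym (negPf ne_jk) mulr0.
move=> x y; apply/rowP => k; rewrite [in LHS]natural_mulE mxE linear_sum /=.
rewrite /evo_mul summxE; apply: eq_bigr => j _.
by rewrite linearZ /= tnth_mktuple !mxE.
Qed.

End NaturalBasis.

(** Members of a basis are pairwise distinct, so distinct positions in [e'] hold distinct vectors
    and hence come from distinct positions in [e]. This permits sorting a natural basis along the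
    annihilator series. *)
Lemma natural_basis_perm (F : fieldType) (A : algebra F) n (e e' : n.-tuple A) :
  perm_eq e e' -> natural_basis e -> natural_basis e'.
Proof.
move=> ee' [e_basis eM]; have e_uniq := free_uniq (basis_free e_basis).
split=> [|j k ne_jk]; first by rewrite -(perm_basis _ ee').
have /tnthP[j' ej'] : tnth e' j \in e by rewrite (perm_mem ee') mem_tnth.
have /tnthP[k' ek'] : tnth e' k \in e by rewrite (perm_mem ee') mem_tnth.
rewrite ej' ek'; apply: eM; apply: contra_neq ne_jk => jk'.
have : tnth e' j = tnth e' k by rewrite ej' ek' jk'.
by apply/tuple_uniqP; rewrite -(perm_uniq ee').
Qed.

(** * Explicit coordinates in dimension five *)

Section Row5.
Variable R : nzRingType.

Definition row5 (x1 x2 x3 x4 x5 : R) : 'rV[R]_5 :=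
  \row_j [:: x1; x2; x3; x4; x5]`_j.

Lemma row5P (x : 'rV[R]_5) :
  exists x1 x2 x3 x4 x5, x = row5 x1 x2 x3 x4 x5.
Proof.
exists (x 0 (inord 0)), (x 0 (inord 1)), (x 0 (inord 2)), (x 0 (inord 3)).
exists (x 0 (inord 4)); apply/rowP; case=> [[|[|[|[|[|//]]]]] lt5];
  by rewrite mxE /=; congr (x 0 _); apply/val_inj; rewrite /= inordK.
Qed.

Lemma row5_inj x1 x2 x3 x4 x5 y1 y2 y3 y4 y5 :
    row5 x1 x2 x3 x4 x5 = row5 y1 y2 y3 y4 y5 ->
  [/\ x1 = y1, x2 = y2, x3 = y3, x4 = y4 & x5 = y5].
Proof.
move=> /rowP eq_xy.
by split; [move: (eq_xy (inord 0)) | move: (eq_xy (inord 1))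
          | move: (eq_xy (inord 2)) | move: (eq_xy (inord 3))
          | move: (eq_xy (inord 4))]; rewrite !mxE !inordK.
Qed.

Lemma row5D x1 x2 x3 x4 x5 y1 y2 y3 y4 y5 :
  row5 x1 x2 x3 x4 x5 + row5 y1 y2 y3 y4 y5 =
  row5 (x1 + y1) (x2 + y2) (x3 + y3) (x4 + y4) (x5 + y5).
Proof.
by apply/rowP; case=> [[|[|[|[|[|//]]]]] lt5]; rewrite !mxE.
Qed.

Lemma row5Z a x1 x2 x3 x4 x5 :
  a *: row5 x1 x2 x3 x4 x5 =
  row5 (a * x1) (a * x2) (a * x3) (a * x4) (a * x5).
Proof.
by apply/rowP; case=> [[|[|[|[|[|//]]]]] lt5]; rewrite !mxE.
Qed.

Lemma row5_0 : row5 0 0 0 0 0 = 0.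
Proof.
by apply/rowP; case=> [[|[|[|[|[|//]]]]] lt5]; rewrite !mxE.
Qed.

Lemma row5_delta m : (m < 5)%N ->
  delta_mx 0 (inord m) =
  row5 (m == 0)%:R (m == 1)%:R (m == 2)%:R (m == 3)%:R (m == 4)%:R.
Proof.
move=> lt_m5; apply/rowP; case=> [[|[|[|[|[|//]]]]] lt5];
  by rewrite !mxE eqxx -val_eqE /= inordK // eq_sym.
Qed.

End Row5.

(** * Evolution algebras with a triangular table of squares *)

Section Triangular.
Variable F : fieldType.

(** The zeros are those forced by a natural basis sorted along an annihilator series of type
    [1,1,2,1], where e2 and e3 share a layer. *)
Definition tri (a2 a3 a4 a5 b4 b5 c4 c5 d5 : F) : algebra F :=
  evo_algebra [tuple row5 0 a2 a3 a4 a5; row5 0 0 0 b4 b5;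
                     row5 0 0 0 c4 c5; row5 0 0 0 0 d5; row5 0 0 0 0 0].

Lemma tri_mulE a2 a3 a4 a5 b4 b5 c4 c5 d5 x1 x2 x3 x4 x5 y1 y2 y3 y4 y5 :
  @amul F (tri a2 a3 a4 a5 b4 b5 c4 c5 d5)
     (row5 x1 x2 x3 x4 x5) (row5 y1 y2 y3 y4 y5) =
  row5 0 (x1 * y1 * a2) (x1 * y1 * a3)
    (x1 * y1 * a4 + x2 * y2 * b4 + x3 * y3 * c4)
    (x1 * y1 * a5 + x2 * y2 * b5 + x3 * y3 * c5 + x4 * y4 * d5).
Proof.
rewrite [LHS]/(evo_mul _ _ _) /evo_mul !big_ord_recl big_ord0 /=.
rewrite !(tnth_nth 0) /= !mxE /= addr0 !row5Z !row5D.
by congr row5; ring.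
Qed.

(** The map sends e1 to r e1, e2 to p2 e2 + p3 e3 + p5 e5, e3 to q2 e2 + q3 e3 + q5 e5, e4 to s4 e4
    + s5 e5 and e5 to t e5. The inequalities make it invertible; the equations compare the images of
    the squares and of e2 e3 coordinate by coordinate. *)
Lemma tri_isomorphic a2 a3 a4 a5 b4 b5 c4 c5 d5 a2' a3' a4' a5' b4' b5' c4' c5' d5'
    r p2 p3 p5 q2 q3 q5 s4 s5 t :
    r != 0 -> p2 * q3 - p3 * q2 != 0 -> s4 != 0 -> t != 0 ->
    r ^+ 2 * a2' = a2 * p2 + a3 * q2 ->
    r ^+ 2 * a3' = a2 * p3 + a3 * q3 ->
    r ^+ 2 * a4' = a4 * s4 ->
    r ^+ 2 * a5' = a2 * p5 + a3 * q5 + a4 * s5 + a5 * t ->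
    p2 ^+ 2 * b4' + p3 ^+ 2 * c4' = b4 * s4 ->
    p2 ^+ 2 * b5' + p3 ^+ 2 * c5' = b4 * s5 + b5 * t ->
    p2 * q2 * b4' + p3 * q3 * c4' = 0 ->
    p2 * q2 * b5' + p3 * q3 * c5' = 0 ->
    q2 ^+ 2 * b4' + q3 ^+ 2 * c4' = c4 * s4 ->
    q2 ^+ 2 * b5' + q3 ^+ 2 * c5' = c4 * s5 + c5 * t ->
    s4 ^+ 2 * d5' = d5 * t ->
  isomorphic (tri a2 a3 a4 a5 b4 b5 c4 c5 d5)
             (tri a2' a3' a4' a5' b4' b5' c4' c5' d5').
Proof.
move=> r0 D0 s0 t0 ea2 ea3 ea4 ea5 eb4 eb5 eo4 eo5 ec4 ec5 ed5.
pose g (x : 'rV[F]_5) : 'rV[F]_5 :=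
  let c k := x 0 (inord k) in
  row5 (r * c 0) (p2 * c 1 + q2 * c 2) (p3 * c 1 + q3 * c 2) (s4 * c 3)
       (p5 * c 1 + q5 * c 2 + s5 * c 3 + t * c 4).
have gE x1 x2 x3 x4 x5 : g (row5 x1 x2 x3 x4 x5) =
    row5 (r * x1) (p2 * x2 + q2 * x3) (p3 * x2 + q3 * x3) (s4 * x4)
       (p5 * x2 + q5 * x3 + s5 * x4 + t * x5).
  by rewrite /g !mxE !inordK.
apply: (@isomorphicI F (tri _ _ _ _ _ _ _ _ _) (tri _ _ _ _ _ _ _ _ _) g).
- move=> a x y; have [x1 [x2 [x3 [x4 [x5 ->]]]]] := row5P x.
  have [y1 [y2 [y3 [y4 [y5 ->]]]]] := row5P y.
  by rewrite row5Z row5D !gE row5Z row5D; congr row5; ring.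
(* The inverse uses Cramer's rule on the span of e2 and e3, then back-substitution in the last
   coordinate. *)
- pose D := p2 * q3 - p3 * q2.
  pose h2 x2 x3 := (q3 * x2 - q2 * x3) / D.
  pose h3 x2 x3 := (p2 * x3 - p3 * x2) / D.
  pose h (x : 'rV[F]_5) : 'rV[F]_5 :=
    let c k := x 0 (inord k) in
    row5 (c 0 / r) (h2 (c 1) (c 2)) (h3 (c 1) (c 2)) (c 3 / s4)
         ((c 4 - p5 * h2 (c 1) (c 2) - q5 * h3 (c 1) (c 2) - s5 * (c 3 / s4)) / t).
  have hE x1 x2 x3 x4 x5 : h (row5 x1 x2 x3 x4 x5) =
      row5 (x1 / r) (h2 x2 x3) (h3 x2 x3) (x4 / s4)
         ((x5 - p5 * h2 x2 x3 - q5 * h3 x2 x3 - s5 * (x4 / s4)) / t).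
    by rewrite /h !mxE !inordK.
  exists h => x; have [x1 [x2 [x3 [x4 [x5 ->]]]]] := row5P x.
    by rewrite gE hE /h2 /h3 /D; congr row5; field; rewrite ?D0 ?s0 ?t0.
  by rewrite hE gE /h2 /h3 /D; congr row5; field; rewrite ?D0 ?s0 ?t0.
move=> x y; have [x1 [x2 [x3 [x4 [x5 ->]]]]] := row5P x.
have [y1 [y2 [y3 [y4 [y5 ->]]]]] := row5P y.
rewrite tri_mulE !gE tri_mulE; congr row5.
- by rewrite mulr0.
- have -> : r * x1 * (r * y1) * a2' = x1 * y1 * (r ^+ 2 * a2') by ring.
  by rewrite ea2; ring.
- have -> : r * x1 * (r * y1) * a3' = x1 * y1 * (r ^+ 2 * a3') by ring.
  by rewrite ea3; ring.
- transitivity (x1 * y1 * (a4 * s4) + x2 * y2 * (b4 * s4) + x3 * y3 * (c4 * s4)).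
    by ring.
  (* The product of the images has mixed terms, x2 y3 + x3 y2 times the left side of [eo4]; that
     multiple of zero is added to the other side before [ring]. *)
  rewrite -ea4 -eb4 -ec4 -[LHS]addr0 -[X in _ + X](mulr0 (x2 * y3 + x3 * y2)).
  by rewrite -eo4; ring.
transitivity (x1 * y1 * (a2 * p5 + a3 * q5 + a4 * s5 + a5 * t)
  + x2 * y2 * (b4 * s5 + b5 * t) + x3 * y3 * (c4 * s5 + c5 * t)
  + x4 * y4 * (d5 * t)).
  by ring.
rewrite -ea5 -eb5 -ec5 -ed5 -[LHS]addr0.
by rewrite -[X in _ + X](mulr0 (x2 * y3 + x3 * y2)) -eo5; ring.
Qed.

End Triangular.

(** * The four-parameter normal form and its isomorphisms *)

Section NormalForms.
Variable F : fieldType.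

(** The parameter [d] is what remains of the difference e3^2 - e2^2, a multiple of e5. *)
Definition nform (a2 a3 a4 d : F) : algebra F := tri a2 a3 a4 0 1 0 1 d 1.

Lemma nform_mulE a2 a3 a4 d x1 x2 x3 x4 x5 y1 y2 y3 y4 y5 :
  @amul F (nform a2 a3 a4 d) (row5 x1 x2 x3 x4 x5) (row5 y1 y2 y3 y4 y5) =
  row5 0 (x1 * y1 * a2) (x1 * y1 * a3)
    (x1 * y1 * a4 + x2 * y2 + x3 * y3) (x3 * y3 * d + x4 * y4).
Proof. by rewrite tri_mulE; congr row5; ring. Qed.

(* The restriction of an isomorphism to the span of e1, e2, e3, modulo the span
   of e4 and e5, is e1 |-> r e1, e2 |-> p2 e2 + p3 e3, e3 |-> q2 e2 + q3 e3. *)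
Definition nform_transform (a2 a3 a4 d b2 b3 b4 d' r p2 p3 q2 q3 : F) : Prop :=
  let s := p2 ^+ 2 + p3 ^+ 2 in
  [/\ r != 0, s != 0, q2 ^+ 2 + q3 ^+ 2 = s & p2 * q2 + p3 * q3 = 0] /\
  [/\ p3 * q3 * d' = 0, q3 ^+ 2 * d' = p3 ^+ 2 * d' + d * s ^+ 2,
      r ^+ 2 * b2 = a2 * p2 + a3 * q2, r ^+ 2 * b3 = a2 * p3 + a3 * q3 &
      r ^+ 2 * b4 = a4 * s].

(** Since e4 = e2^2 and e5 = e4^2, the images of e1, e2, e3 determine the isomorphism. Their
    components along e5 impose no further condition, because a nonzero [a2] or [a3] leaves room to
    adjust them. *)
Lemma nform_isomorphicP a2 a3 a4 d b2 b3 b4 d' :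
    (a2 != 0) || (a3 != 0) -> (b2 != 0) || (b3 != 0) ->
  isomorphic (nform a2 a3 a4 d) (nform b2 b3 b4 d') <->
  exists r p2 p3 q2 q3, nform_transform a2 a3 a4 d b2 b3 b4 d' r p2 p3 q2 q3.
Proof.
move=> a_neq0 b_neq0; split; last first.
  move=> [r [p2 [p3 [q2 [q3 [[r0 s0 eqs edot] [eod ed eb2 eb3 eb4]]]]]]].
  pose s := p2 ^+ 2 + p3 ^+ 2.
  (* By Lagrange's identity the squared determinant is the product of the two norms minus the
     squared dot product, which is s^2. *)
  have det0 : p2 * q3 - p3 * q2 != 0.
    rewrite -sqrf_eq0; suff -> : (p2 * q3 - p3 * q2) ^+ 2 = s ^+ 2.
      by rewrite sqrf_eq0.
    transitivity (s * (q2 ^+ 2 + q3 ^+ 2) - (p2 * q2 + p3 * q3) ^+ 2).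
      by rewrite /s; ring.
    by rewrite eqs edot /s; ring.
  (* The e5-components of the images of e2 and e3 must cancel the e5-part contributed by the image
     of a4 e4. *)
  have [p5 [q5 e5]] : exists p5 q5, a2 * p5 + a3 * q5 = - (a4 * (p3 ^+ 2 * d')).
    have [a2_0 | a2_0] := eqVneq a2 0.
      move: a_neq0; rewrite a2_0 eqxx /= => a3_0.
      by exists 0, (- (a4 * (p3 ^+ 2 * d')) / a3); field.
    by exists (- (a4 * (p3 ^+ 2 * d')) / a2), 0; field.
  (* The last three values are forced: e4 = e2^2 goes to s e4 + p3^2 d' e5, and e5 = e4^2 goes to
     s^2 e5. *)
  apply: (@tri_isomorphic _ _ _ _ _ _ _ _ _ _ _ _ _ _ _ _ _ _ _
    r p2 p3 p5 q2 q3 q5 s (p3 ^+ 2 * d') (s ^+ 2)) => //; try exact: expf_neq0.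
  - by rewrite e5; ring.
  - by rewrite /s; ring.
  - by ring.
  - by rewrite !mulr1.
  - by rewrite mulr0 add0r.
  - by rewrite -/s in eqs; rewrite -eqs; ring.
  - by rewrite mulr0 add0r ed mul1r.
  - by ring.
move=> [f [[g fK gK] fM]].
pose e1 : nform a2 a3 a4 d := row5 1 0 0 0 0.
pose e2 : nform a2 a3 a4 d := row5 0 1 0 0 0.
pose e3 : nform a2 a3 a4 d := row5 0 0 1 0 0.
pose e4 : nform a2 a3 a4 d := row5 0 0 0 1 0.
pose e5 : nform a2 a3 a4 d := row5 0 0 0 0 1.
have e11 : amul e1 e1 = a2 *: e2 + a3 *: e3 + a4 *: e4.
  by rewrite /e1 nform_mulE !row5Z !row5D; congr row5; ring.
have e22 : amul e2 e2 = e4 by rewrite /e2 nform_mulE; congr row5; ring.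
have e33 : amul e3 e3 = e4 + d *: e5.
  by rewrite /e3 nform_mulE !row5Z !row5D; congr row5; ring.
have e44 : amul e4 e4 = e5 by rewrite /e4 nform_mulE; congr row5; ring.
have e12 : amul e1 e2 = 0.
  by rewrite /e1 nform_mulE -row5_0; congr row5; ring.
have e13 : amul e1 e3 = 0.
  by rewrite /e1 nform_mulE -row5_0; congr row5; ring.
have e14 : amul e1 e4 = 0.
  by rewrite /e1 nform_mulE -row5_0; congr row5; ring.
have e23 : amul e2 e3 = 0.
  by rewrite /e2 nform_mulE -row5_0; congr row5; ring.
have e24 : amul e2 e4 = 0.
  by rewrite /e2 nform_mulE -row5_0; congr row5; ring.
have e34 : amul e3 e4 = 0.
  by rewrite /e3 nform_mulE -row5_0; congr row5; ring.
have e5l x : amul e5 x = 0.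
  have [x1 [x2 [x3 [x4 [x5 ->]]]]] := row5P x.
  by rewrite /e5 nform_mulE -row5_0; congr row5; ring.
have e4l x : exists c, amul e4 x = c *: e5.
  have [x1 [x2 [x3 [x4 [x5 ->]]]]] := row5P x.
  by exists x4; rewrite /e4 nform_mulE row5Z; congr row5; ring.
have e2l x : exists c, amul e2 x = c *: e4.
  have [x1 [x2 [x3 [x4 [x5 ->]]]]] := row5P x.
  by exists x2; rewrite /e2 nform_mulE row5Z; congr row5; ring.
have e3l x : exists c, amul e3 x = c *: (e4 + d *: e5).
  have [x1 [x2 [x3 [x4 [x5 ->]]]]] := row5P x.
  by exists x3; rewrite /e3 nform_mulE !row5Z !row5D row5Z; congr row5; ring.
have e5_neq0 : e5 != 0.
  apply/eqP; rewrite -row5_0 => /row5_inj[_ _ _ _ /eqP].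
  by rewrite oner_eq0.
(* Multiplication by e1 in the target turns an e1-coordinate y into y b2 and y b3, so this is the
   test that kills e1-coordinates of images. *)
have b_reg y : y * b2 = 0 -> y * b3 = 0 -> y = 0.
  move=> /eqP yb2 /eqP yb3; apply/eqP; move: yb2 yb3 b_neq0; rewrite !mulf_eq0.
  by case: (y == 0) => //= -> ->.
(* An isomorphism preserves the annihilator series, so it maps e5 into <e5>,
   e4 into <e4, e5>, and e2, e3 into <e2, e3, e4, e5>. *)
have [t fe5] : exists t, f e5 = row5 0 0 0 0 t.
  have [o1 [o2 [o3 [o4 [o5 fe5]]]]] := row5P (f e5).
  have fe5l y1 y2 y3 y4 y5 :
      @amul F (nform b2 b3 b4 d') (f e5) (row5 y1 y2 y3 y4 y5) = row5 0 0 0 0 0.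
    by rewrite -[X in amul _ X]gK -fM e5l linear0 row5_0.
  exists o5; move: fe5l; rewrite fe5 => fe5l.
  have := fe5l 1 0 0 0 0; rewrite nform_mulE => /row5_inj[_ o1b2 o1b3 _ _].
  have := fe5l 0 1 0 0 0; rewrite nform_mulE => /row5_inj[_ _ _ eo2 _].
  have := fe5l 0 0 1 0 0; rewrite nform_mulE => /row5_inj[_ _ _ eo3 _].
  have := fe5l 0 0 0 1 0; rewrite nform_mulE => /row5_inj[_ _ _ _ eo4].
  congr row5; first by apply: b_reg; rewrite -[o1]mulr1.
  - by rewrite -eo2; ring.
  - by rewrite -eo3; ring.
  - by rewrite -eo4; ring.
have [m4 [m5 fe4]] : exists m4 m5, f e4 = row5 0 0 0 m4 m5.
  have [o1 [o2 [o3 [o4 [o5 fe4]]]]] := row5P (f e4).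
  have fe4l y1 y2 y3 y4 y5 : exists c,
      @amul F (nform b2 b3 b4 d') (f e4) (row5 y1 y2 y3 y4 y5) = row5 0 0 0 0 c.
    have [c ec] := e4l (g (row5 y1 y2 y3 y4 y5)); exists (c * t).
    by rewrite -[X in amul _ X]gK -fM ec linearZ /= fe5 row5Z !mulr0.
  exists o4, o5; move: fe4l; rewrite fe4 => fe4l.
  have [c1] := fe4l 1 0 0 0 0; rewrite nform_mulE => /row5_inj[_ o1b2 o1b3 _ _].
  have [c2] := fe4l 0 1 0 0 0; rewrite nform_mulE => /row5_inj[_ _ _ eo2 _].
  have [c3] := fe4l 0 0 1 0 0; rewrite nform_mulE => /row5_inj[_ _ _ eo3 _].
  congr row5; first by apply: b_reg; rewrite -[o1]mulr1.
  - by rewrite -eo2; ring.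
  - by rewrite -eo3; ring.
(* One argument serves e2, with [y5] = 0, and e3, with [y5] = [d]: in both cases x times anything is
   a multiple of one fixed vector of the span of e4 and e5. *)
have fl x y5 : (forall z, exists c, amul x z = c *: (e4 + y5 *: e5)) ->
   exists x2 x3 x4 x5, f x = row5 0 x2 x3 x4 x5.
  move=> xl; have [o1 [o2 [o3 [o4 [o5 fx]]]]] := row5P (f x).
  have [c] := xl (g (row5 1 0 0 0 0)); move/(congr1 f).
  rewrite fM gK fx nform_mulE linearZ /= linearD linearZ /= fe4 fe5.
  rewrite !row5Z row5D row5Z => /row5_inj[_ o1b2 o1b3 _ _].
  exists o2, o3, o4, o5; congr row5.
  by apply: b_reg; [rewrite -[o1]mulr1 o1b2 | rewrite -[o1]mulr1 o1b3]; ring.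
have [|p2 [p3 [p4 [p5 fe2]]]] := fl e2 0.
  by move=> z; have [c ->] := e2l z; exists c; rewrite scale0r addr0.
have [|q2 [q3 [q4 [q5 fe3]]]] := fl e3 d.
  by move=> z; have [c ->] := e3l z; exists c.
have [r [r2 [r3 [r4 [r5 fe1]]]]] := row5P (f e1).
have f44 := fM e4 e4; have f24 := fM e2 e4; have f34 := fM e3 e4.
have f14 := fM e1 e4; have f23 := fM e2 e3; have f12 := fM e1 e2.
have f13 := fM e1 e3; have f22 := fM e2 e2; have f33 := fM e3 e3.
have f11 := fM e1 e1.
have row0 : 0 = row5 0 0 0 0 0 :> nform b2 b3 b4 d' by rewrite row5_0.
move: f44; rewrite e44 fe4 fe5 nform_mulE => /row5_inj[_ _ _ _].
rewrite !mul0r add0r => et.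
have m4_neq0 : m4 != 0.
  apply: contraNneq e5_neq0 => m4_0; rewrite -(inj_eq (can_inj fK)) fe5 et m4_0.
  by rewrite mul0r linear0 row5_0.
(* Since e4 annihilates e1, e2 and e3, the e4-coordinates of their images, multiplied by m4,
   vanish. *)
have m4_reg y : 0 = y * m4 -> y = 0.
  by move/esym/eqP; rewrite mulf_eq0 (negPf m4_neq0) orbF => /eqP.
move: f24; rewrite e24 fe4 fe2 linear0 row0 nform_mulE => /row5_inj[_ _ _ _].
rewrite mulr0 mul0r add0r => /m4_reg p4_0.
move: f34; rewrite e34 fe4 fe3 linear0 row0 nform_mulE => /row5_inj[_ _ _ _].
rewrite mulr0 mul0r add0r => /m4_reg q4_0.
move: f14; rewrite e14 fe4 fe1 linear0 row0 nform_mulE => /row5_inj[_ _ _ _].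
rewrite mulr0 mul0r add0r => /m4_reg r4_0.
subst p4 q4 r4.
move: f22; rewrite e22 fe4 fe2 nform_mulE => /row5_inj[_ _ _ em4 em5].
move: f33; rewrite fe3 nform_mulE e33 linearD linearZ /= fe4 fe5 row5Z row5D.
move=> /row5_inj[_ _ _ eq4 eq5].
move: f23; rewrite e23 linear0 row0 fe2 fe3 nform_mulE => /row5_inj[_ _ _ eo4 eo5].
move: f12; rewrite e12 linear0 row0 fe2 fe1 nform_mulE => /row5_inj[_ _ _ erp _].
move: f13; rewrite e13 linear0 row0 fe3 fe1 nform_mulE => /row5_inj[_ _ _ erq _].
move: f11; rewrite fe1 nform_mulE e11 !linearD !linearZ /= fe2 fe3 fe4 !row5Z !row5D.
move=> /row5_inj[_ eb2 eb3 eb4 eb5].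
pose s := p2 ^+ 2 + p3 ^+ 2.
have ms : m4 = s by rewrite em4 /s; ring.
have qs : q2 ^+ 2 + q3 ^+ 2 = s.
  by rewrite -ms -[m4]addr0 -(mulr0 d) eq4; ring.
have dot0 : p2 * q2 + p3 * q3 = 0 by rewrite [RHS]eo4; ring.
have det0 : p2 * q3 - p3 * q2 != 0.
  rewrite -sqrf_eq0; suff -> : (p2 * q3 - p3 * q2) ^+ 2 = m4 ^+ 2.
    by rewrite sqrf_eq0.
  transitivity (s * (q2 ^+ 2 + q3 ^+ 2) - (p2 * q2 + p3 * q3) ^+ 2).
    by rewrite /s; ring.
  by rewrite qs dot0 ms /s; ring.
have rp : r2 * p2 + r3 * p3 = 0 by rewrite [RHS]erp; ring.
have rq : r2 * q2 + r3 * q3 = 0 by rewrite [RHS]erq; ring.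
have det_reg y : y * (p2 * q3 - p3 * q2) = 0 -> y = 0.
  by move/eqP; rewrite mulf_eq0 (negPf det0) orbF => /eqP.
(* The vector (r2, r3) is orthogonal to the independent vectors (p2, p3) and (q2, q3), hence
   zero. *)
have r2_0 : r2 = 0.
  apply: det_reg; transitivity ((r2 * p2 + r3 * p3) * q3 - (r2 * q2 + r3 * q3) * p3).
    by ring.
  by rewrite rp rq; ring.
have r3_0 : r3 = 0.
  apply: det_reg; transitivity ((r2 * q2 + r3 * q3) * p2 - (r2 * p2 + r3 * p3) * q2).
    by ring.
  by rewrite rp rq; ring.
subst r2 r3; rewrite !mulr0 !addr0 in eb2 eb3 eb4 eb5.
exists r, p2, p3, q2, q3; split; split=> //; rewrite -/s.
(* If r were 0, the image of e1^2 would vanish, and injectivity would give a2 = a3 = 0. *)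
- apply: contraTneq isT => r0; have : f (amul e1 e1) = 0.
    by rewrite fM fe1 nform_mulE r0 row0; congr row5; ring.
  move/(congr1 g); rewrite fK -(linear0 f) fK e11 !row5Z !row5D -row5_0.
  move=> /row5_inj[_]; rewrite !mulr0 !mulr1 !addr0 !add0r => a20 a30 _ _.
  by move: a_neq0; rewrite a20 a30 eqxx.
- by rewrite -ms.
- by rewrite [RHS]eo5; ring.
- transitivity (m5 + d * t); first by rewrite eq5; ring.
  by rewrite em5 et ms; ring.
- by rewrite expr2 -eb4 add0r ms.
Qed.

(** The case of a diagonal similitude, e2 to p e2 and e3 to q e3 with q = p or q = -p. *)
Lemma nform_scale a2 a3 a4 d b2 b3 b4 d' r p q :
    (a2 != 0) || (a3 != 0) -> (b2 != 0) || (b3 != 0) ->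
    r != 0 -> p != 0 -> q ^+ 2 = p ^+ 2 -> d' = d * p ^+ 2 ->
    r ^+ 2 * b2 = a2 * p -> r ^+ 2 * b3 = a3 * q -> r ^+ 2 * b4 = a4 * p ^+ 2 ->
  isomorphic (nform a2 a3 a4 d) (nform b2 b3 b4 d').
Proof.
move=> a0 b0 r0 p0 eq2 ed eb2 eb3 eb4; apply/nform_isomorphicP => //.
exists r, p, 0, 0, q; split; split=> //; rewrite ?expr0n ?eq2 ?ed ?eb2 ?eb3 ?eb4 /=;
  by [rewrite addr0 expf_neq0 | ring].
Qed.

(** The case of an antidiagonal similitude, e2 to p e3 and e3 to q e2. Exchanging the roles of e2
    and e3 reverses the sign of e3^2 - e2^2, hence the sign in [d']. *)
Lemma nform_swap a2 a3 a4 d b2 b3 b4 d' r p q :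
    (a2 != 0) || (a3 != 0) -> (b2 != 0) || (b3 != 0) ->
    r != 0 -> p != 0 -> q ^+ 2 = p ^+ 2 -> d' = - (d * p ^+ 2) ->
    r ^+ 2 * b2 = a3 * q -> r ^+ 2 * b3 = a2 * p -> r ^+ 2 * b4 = a4 * p ^+ 2 ->
  isomorphic (nform a2 a3 a4 d) (nform b2 b3 b4 d').
Proof.
move=> a0 b0 r0 p0 eq2 ed eb2 eb3 eb4; apply/nform_isomorphicP => //.
exists r, 0, p, q, 0; split; split=> //; rewrite ?expr0n ?eq2 ?ed ?eb2 ?eb3 ?eb4 /=;
  by [rewrite add0r expf_neq0 | ring].
Qed.

End NormalForms.

(** * From type [1,1,2,1] to a triangular table *)

Lemma sum_ord5 (V : nmodType) (g : 'I_5 -> V) :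
  \sum_j g j = g (inord 0) + g (inord 1) + g (inord 2) + g (inord 3) + g (inord 4).
Proof.
rewrite !big_ord_recl big_ord0 addr0 !addrA.
by do !congr (_ + _); congr g; apply/val_inj; rewrite /= inordK.
Qed.

Section Type1121.
Variables (F : fieldType) (A : algebra F).

Lemma ann_iterS j : (ann_iter A j <= ann_iter A j.+1)%VS.
Proof.
elim: j => [|j IHj]; first exact: sub0v.
apply/subvP => x /ann_modP x_ann; apply/ann_modP => y.
by have [xy yx] := x_ann y; split; apply: (subvP IHj).
Qed.

Lemma type1121_dim : has_type A [:: 1; 1; 2; 1]%N ->
  [/\ \dim (ann_iter A 1) = 1%N, \dim (ann_iter A 2) = 2%N,
      \dim (ann_iter A 3) = 4%N, \dim (ann_iter A 4) = 5%N &
      ann_iter A 4 = fullv].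
Proof.
case=> r [annr _ types]; have := congr1 size types; rewrite size_map size_iota.
move=> /= r4; rewrite -r4 in annr types.
pose D j : nat := \dim (ann_iter A j); rewrite -/(D 1%N) -/(D 2%N) -/(D 3%N) -/(D 4%N).
(* The type uses truncated subtraction; monotonicity makes its entries genuine differences, so that
   the dimensions are their partial sums. *)
have D_le j : (D j <= D j.+1)%N by rewrite dimvS ?ann_iterS.
have D0 : D 0%N = 0%N by rewrite [D 0]dimv0.
have : [:: 1; 1; 2; 1]%N = [seq (D j - D j.-1)%N | j <- iota 1 4] by [].
have := (D_le 0, D_le 1, D_le 2, D_le 3)%N; move: D D0 {D_le types} => D D0 /=.
by move=> [[[D01 D12] D23] D34] [d1 d2 d3 d4]; split=> //=; lia.
Qed.

(** Each ann^j contains as many basis vectors as its dimension, so the successive layers [f 1],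
    [l 1], [l 2], [l 3] contain 1, 1, 2, 1 of them; the basis is listed from the top layer down. *)
Lemma type1121_basis : evolution_algebra A -> has_type A [:: 1; 1; 2; 1]%N ->
  exists u1 u2 u3 u4 u5 : A, natural_basis [tuple u1; u2; u3; u4; u5] /\
  [/\ u5 \in ann_iter A 1,
      u4 \in ann_iter A 2 /\ u4 \notin ann_iter A 1,
      u3 \in ann_iter A 3 /\ u3 \notin ann_iter A 2,
      u2 \in ann_iter A 3 /\ u2 \notin ann_iter A 2 &
      u1 \in ann_iter A 4 /\ u1 \notin ann_iter A 3].
Proof.
move=> [n [e e_nat]] /type1121_dim[d1 d2 d3 d4 full4].
have n5 : n = 5%N.
  by rewrite -d4 full4 (size_basis e_nat.1).
subst n; pose f j := [seq x <- e | x \in ann_iter A j].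
pose l j := [seq x <- f j.+1 | x \notin ann_iter A j].
have size_f j : size (f j.+1) = \dim (ann_iter A j.+1).
  by rewrite size_filter (dim_natural_ann_mod e_nat).
have perm_f j : perm_eq (f j.+1) (l j ++ f j).
  have -> : f j = [seq x <- f j.+1 | x \in ann_iter A j].
    rewrite -filter_predI; apply: eq_filter => x /=.
    by case: (boolP (x \in ann_iter A j)) => // /(subvP (ann_iterS j)) ->.
  by rewrite perm_sym perm_catC perm_filterC.
have size_l j : size (l j) = (size (f j.+1) - size (f j))%N.
  by rewrite (perm_size (perm_f j)) size_cat addnK.
have l_mem j x : x \in l j -> x \in ann_iter A j.+1 /\ x \notin ann_iter A j.
  by rewrite !mem_filter => /andP[-> /andP[->]].
have f4 : f 4%N = e.
  by rewrite -[RHS]filter_predT; apply: eq_filter => x; rewrite full4 memvf.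
have perm_e : perm_eq e (l 3%N ++ l 2%N ++ l 1%N ++ f 1%N).
  rewrite -f4; apply: perm_trans (perm_f _) _; rewrite perm_cat2l.
  by apply: perm_trans (perm_f _) _; rewrite perm_cat2l.
have [u5 f1E] : exists x, f 1%N = [:: x].
  by have := size_f 0%N; rewrite d1; case: (f 1%N) => [|x []] // _; exists x.
have [u4 l1E] : exists x, l 1%N = [:: x].
  have := size_l 1%N; rewrite !size_f d1 d2.
  by case: (l 1%N) => [|x []] // _; exists x.
have [u2 [u3 l2E]] : exists x y, l 2%N = [:: x; y].
  have := size_l 2%N; rewrite !size_f d2 d3.
  by case: (l 2%N) => [|x [|y []]] // _; exists x, y.
have [u1 l3E] : exists x, l 3%N = [:: x].
  have := size_l 3%N; rewrite !size_f d3 d4.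
  by case: (l 3%N) => [|x []] // _; exists x.
rewrite f1E l1E l2E l3E in perm_e.
exists u1, u2, u3, u4, u5.
split; first exact: natural_basis_perm perm_e e_nat.
split.
- by have := mem_head u5 [::]; rewrite -f1E mem_filter => /andP[].
- by apply: l_mem; rewrite l1E mem_head.
- by apply: l_mem; rewrite l2E in_cons mem_head orbT.
- by apply: l_mem; rewrite l2E mem_head.
by apply: l_mem; rewrite l3E mem_head.
Qed.

(** A basis vector lies in ann^(m+1) exactly when its square lies in ann^m. Membership gives the
    zeros of the table, non-membership the nonvanishing coefficients. *)
Lemma type1121_tri : evolution_algebra A -> has_type A [:: 1; 1; 2; 1]%N ->
  exists a2 a3 a4 a5 b4 b5 c4 c5 d5,
  [/\ (a2 != 0) || (a3 != 0), b4 != 0, c4 != 0 & d5 != 0] /\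
  isomorphic A (tri a2 a3 a4 a5 b4 b5 c4 c5 d5).
Proof.
move=> A_evo A_type; have [_ _ _ _ full4] := type1121_dim A_type.
have [u1 [u2 [u3 [u4 [u5 [u_nat [u5_1 [u4_2 u4_1] [u3_3 u3_2] [u2_3 u2_2]
  [u1_4 u1_3]]]]]]]] := type1121_basis A_evo A_type.
have sub12 := subvP (ann_iterS 1); have sub23 := subvP (ann_iterS 2).
have u1_2 := contra (sub23 _) u1_3; have u1_1 := contra (sub12 _) u1_2.
have u2_1 := contra (sub12 _) u2_2; have u3_1 := contra (sub12 _) u3_2.
pose u := [tuple u1; u2; u3; u4; u5]; pose c k x := coord u (inord k) x.
have xE x : x = c 0%N x *: u1 + c 1%N x *: u2 + c 2%N x *: u3 + c 3%N x *: u4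
    + c 4%N x *: u5.
  by rewrite {1}(natural_coordE u_nat x) sum_ord5 !(tnth_nth 0) !inordK.
have coordsE x : \row_k coord u k x =
    row5 (c 0%N x) (c 1%N x) (c 2%N x) (c 3%N x) (c 4%N x).
  have [x1 [x2 [x3 [x4 [x5 xx]]]]] := row5P (\row_k coord u k x).
  have /rowP cx := xx; rewrite xx /c.
  by congr row5; [move: (cx (inord 0)) | move: (cx (inord 1))
    | move: (cx (inord 2)) | move: (cx (inord 3)) | move: (cx (inord 4))];
    rewrite !mxE inordK.
have u_tnth k : (k < 5)%N -> [:: u1; u2; u3; u4; u5]`_k = tnth u (inord k).
  by move=> lt_k5; rewrite (tnth_nth 0) inordK.
(* The index is shifted: [c0 k m] speaks of ann^(m+1), which unfolds to an [ann_mod]. *)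
have c0 k m x : (k < 5)%N -> [:: u1; u2; u3; u4; u5]`_k \notin ann_iter A m.+1 ->
    x \in ann_iter A m.+1 -> c k x = 0.
  by move=> lt_k5; rewrite u_tnth // => km xm; apply: natural_ann_mod_coord xm km.
have sqE k m : (k < 5)%N -> ([:: u1; u2; u3; u4; u5]`_k \in ann_iter A m.+1) =
    (amul [:: u1; u2; u3; u4; u5]`_k [:: u1; u2; u3; u4; u5]`_k \in ann_iter A m).
  by move=> /u_tnth ->; apply: natural_ann_mod_tnth.
have sq1 := sqE 0%N _ isT; have sq2 := sqE 1%N _ isT.
have sq3 := sqE 2%N _ isT; have sq4 := sqE 3%N _ isT.
have sq5 := sqE 4%N _ isT; rewrite /= in sq1 sq2 sq3 sq4 sq5.
pose s1 := amul u1 u1; pose s2 := amul u2 u2; pose s3 := amul u3 u3.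
pose s4 := amul u4 u4; pose s5 := amul u5 u5.
have s1_3 : s1 \in ann_iter A 3 by rewrite -sq1.
have s1_2 : s1 \notin ann_iter A 2 by rewrite -sq1.
have s2_2 : s2 \in ann_iter A 2 by rewrite -sq2.
have s2_1 : s2 \notin ann_iter A 1 by rewrite -sq2.
have s3_2 : s3 \in ann_iter A 2 by rewrite -sq3.
have s3_1 : s3 \notin ann_iter A 1 by rewrite -sq3.
have s4_1 : s4 \in ann_iter A 1 by rewrite -sq4.
have s4_0 : s4 \notin ann_iter A 0 by rewrite -sq4.
have s5_0 : s5 = 0 by apply/eqP; rewrite -memv0 -[0%VS]/(ann_iter A 0) -sq5.
exists (c 1%N s1), (c 2%N s1), (c 3%N s1), (c 4%N s1), (c 3%N s2), (c 4%N s2).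
exists (c 3%N s3), (c 4%N s3), (c 4%N s4); split; last first.
  have := natural_basis_isomorphic u_nat; congr (isomorphic A (evo_algebra _)).
  apply/eq_from_tnth => j; rewrite tnth_mktuple coordsE.
  case: j => [[|[|[|[|[|//]]]]] lt5]; rewrite !(tnth_nth 0) /=.
  - by rewrite (c0 0%N 2%N).
  - by rewrite (c0 0%N 1%N) ?(c0 1%N 1%N) ?(c0 2%N 1%N).
  - by rewrite (c0 0%N 1%N) ?(c0 1%N 1%N) ?(c0 2%N 1%N).
  - by rewrite (c0 0%N 0%N) ?(c0 1%N 0%N) ?(c0 2%N 0%N) ?(c0 3%N 0%N).
  by rewrite -/s5 s5_0 /c !linear0.
have c_s2 k : (k < 3)%N -> c k s2 = 0.
  by case: k => [|[|[|//]]] _; [apply: (c0 0%N 1%N) | apply: (c0 1%N 1%N)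
    | apply: (c0 2%N 1%N)].
have c_s3 k : (k < 3)%N -> c k s3 = 0.
  by case: k => [|[|[|//]]] _; [apply: (c0 0%N 1%N) | apply: (c0 1%N 1%N)
    | apply: (c0 2%N 1%N)].
split.
(* Otherwise u1^2 would lie in the span of u4 and u5, hence in ann^2. *)
- rewrite -negb_and; apply: contra s1_2 => /andP[/eqP c1 /eqP c2].
  rewrite (xE s1) c1 c2 (c0 0%N 2%N) // !scale0r !add0r.
  by rewrite memvD // memvZ // sub12.
- apply: contra s2_1 => /eqP c3.
  by rewrite (xE s2) c3 (c_s2 0%N) // (c_s2 1%N) // (c_s2 2%N) // !scale0r !add0r memvZ.
- apply: contra s3_1 => /eqP c3.
  by rewrite (xE s3) c3 (c_s3 0%N) // (c_s3 1%N) // (c_s3 2%N) // !scale0r !add0r memvZ.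
apply: contra s4_0 => /eqP c4; rewrite (xE s4) c4.
by rewrite (c0 0%N 0%N) ?(c0 1%N 0%N) ?(c0 2%N 0%N) ?(c0 3%N 0%N)
  // !scale0r !addr0 mem0v.
Qed.

End Type1121.

(** * Square roots and reduction to the normal form *)

Lemma closed_sqrt (F : closedFieldType) (c : F) : exists x, x ^+ 2 = c.
Proof.
have [x xE] := @solve_monicpoly F 2%N (fun j => if j is 0 then c else 0) isT.
by exists x; rewrite xE !big_ord_recl big_ord0 /= mul0r !addr0 expr0 mulr1.
Qed.

(** The new basis is e1, e2 + p5 e5, s e3 + q5 e5, e2^2 and the square of e2^2. The choice s^2 = b4
    / c4 gives the squares of the second and third vectors equal e4-parts, and p5, q5 absorb the
    e5-part of e1^2. *)
Lemma tri_nform (F : closedFieldType) (a2 a3 a4 a5 b4 b5 c4 c5 d5 : F) :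
    (a2 != 0) || (a3 != 0) -> b4 != 0 -> c4 != 0 -> d5 != 0 ->
  exists a2' a3' a4' d, (a2' != 0) || (a3' != 0) /\
    isomorphic (tri a2 a3 a4 a5 b4 b5 c4 c5 d5) (nform a2' a3' a4' d).
Proof.
move=> a0 b0 c0 d0; have [s s2] := closed_sqrt (b4 / c4).
have s0 : s != 0 by rewrite -sqrf_eq0 s2 mulf_neq0 ?invr_eq0.
exists a2, (a3 / s), (a4 / b4), ((s ^+ 2 * c5 - b5) / (b4 ^+ 2 * d5)).
split; first by rewrite mulf_eq0 invr_eq0 (negPf s0) orbF.
have [p5 [q5 e5]] : exists p5 q5, a2 * p5 + a3 / s * q5 = a5 - a4 / b4 * b5.
  have [a2_0 | a2_0] := eqVneq a2 0.
    move: a0; rewrite a2_0 eqxx /= => a3_0.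
    exists 0, ((a5 - a4 / b4 * b5) / (a3 / s)).
    by field; rewrite a3_0 s0 b0.
  by exists ((a5 - a4 / b4 * b5) / a2), 0; field; rewrite a2_0 b0 s0.
apply: isomorphic_sym.
apply: (@tri_isomorphic _ _ _ _ _ _ _ _ _ _ _ _ _ _ _ _ _ _ _
  1 1 0 p5 0 s q5 b4 b5 (b4 ^+ 2 * d5)).
- exact: oner_neq0.
- by rewrite mul0r subr0 mul1r.
- by [].
- by rewrite mulf_neq0 ?expf_neq0.
- by ring.
- by field.
- by field.
- by rewrite e5; ring.
- by ring.
- by ring.
- by ring.
- by ring.
- by rewrite s2; field.
- by field; rewrite b0 d0.
by ring.
Qed.

(** * The six families as instances of the normal form *)

Section Families.
Variable F : fieldType.

Lemma evo5_nform (a2 a3 a4 d : F) :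
  evo5 (a2 *: delta_mx 0 (inord 1) + a3 *: delta_mx 0 (inord 2)
          + a4 *: delta_mx 0 (inord 3))
       (delta_mx 0 (inord 3) + d *: delta_mx 0 (inord 4)) =
  nform a2 a3 a4 d.
Proof.
congr evo_algebra; apply: val_inj => /=.
by rewrite !row5_delta // -row5_0 !row5Z !row5D; do !congr (_ :: _);
  congr row5; rewrite /=; ring.
Qed.

Lemma E1_nform : E1 F = nform 1 0 0 0.
Proof. by rewrite -evo5_nform !scale0r !addr0 scale1r. Qed.

Lemma E2_nform : E2 F = nform 1 0 1 0.
Proof. by rewrite -evo5_nform !scale0r !addr0 !scale1r. Qed.

Lemma E3_nform (i : F) : E3 i = nform 1 i 0 0.
Proof. by rewrite -evo5_nform !scale0r !addr0 scale1r. Qed.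

Lemma E4_nform (i : F) : E4 i = nform 1 i 1 0.
Proof. by rewrite -evo5_nform !scale0r !addr0 !scale1r. Qed.

Lemma E5_nform (alpha : F) : E5 alpha = nform 1 0 alpha 1.
Proof. by rewrite -evo5_nform !scale0r !addr0 !scale1r. Qed.

Lemma E6_nform (beta gamma : F) : E6 beta gamma = nform beta 1 gamma 1.
Proof. by rewrite -evo5_nform !scale1r. Qed.

End Families.

(** * Every normal form belongs to a family *)

Section Classification.
Variables (F : closedFieldType) (i : F).
Hypothesis i2 : i ^+ 2 = -1.

Lemma nform_family a2 a3 a4 d : (a2 != 0) || (a3 != 0) ->
  exists k (B : algebra F), evo_family i k B /\ isomorphic (nform a2 a3 a4 d) B.
Proof.
move=> a0; have one0 : (1 != 0 :> F) || (i != 0) by rewrite oner_neq0.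
have one0' : (1 != 0 :> F) || (0 != 0 :> F) by rewrite oner_neq0.
have n1 := oner_neq0 F.
have [d_0 | d0] := eqVneq d 0; last first.
  (* Scaling e2 and e3 by k with k^2 = 1/d brings [d] to 1; the choice of r^2 then brings one
     coefficient of e1^2 to 1. *)
  have [k k2] := closed_sqrt (d^-1).
  have k0 : k != 0 by rewrite -sqrf_eq0 k2 invr_eq0.
  have dk : d = (k ^+ 2)^-1 by rewrite k2 invrK.
  have [a3_0 | a3_0] := eqVneq a3 0.
    rewrite {a0} a3_0 eqxx orbF in a0 *.
    have [r r2] := closed_sqrt (a2 * k).
    have r0 : r != 0 by rewrite -sqrf_eq0 r2 mulf_neq0.
    exists 5%N, (E5 (a4 * k ^+ 2 / r ^+ 2)); split; first by constructor.
    rewrite E5_nform; apply: (nform_scale (r := r) (p := k) (q := k)) => //.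
    - by rewrite a0.
    - by rewrite dk; field.
    - by rewrite r2; ring.
    - by ring.
    - by field.
  have [a2_0 | a2_0] := eqVneq a2 0.
    (* The exchange of e2 and e3 changes the sign of [d]; the factor [i] restores it. *)
    have [r r2] := closed_sqrt (a3 * (i * k)).
    have i0 : i != 0 by rewrite -sqrf_eq0 i2 oppr_eq0.
    have r0 : r != 0 by rewrite -sqrf_eq0 r2 !mulf_neq0.
    exists 5%N, (E5 (a4 * (i * k) ^+ 2 / r ^+ 2)); split; first by constructor.
    rewrite E5_nform; apply: (nform_swap (r := r) (p := i * k) (q := i * k)) => //.
    - by rewrite mulf_neq0.
    - by rewrite dk exprMn i2; field.
    - by rewrite r2; ring.
    - by rewrite a2_0; ring.
    - by field.
  have [r r2] := closed_sqrt (a3 * k).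
  have r0 : r != 0 by rewrite -sqrf_eq0 r2 mulf_neq0.
  exists 6%N, (E6 (a2 * k / r ^+ 2) (a4 * k ^+ 2 / r ^+ 2)); split.
    by constructor; rewrite !mulf_neq0 ?invr_eq0 ?expf_neq0.
  rewrite E6_nform; apply: (nform_scale (r := r) (p := k) (q := k)) => //.
  - by rewrite n1 orbT.
  - by rewrite dk; field.
  - by field.
  - by rewrite r2; ring.
  - by field.
subst d; have [m_0 | m0] := eqVneq (a2 ^+ 2 + a3 ^+ 2) 0; last first.
  (* The similitude used below multiplies [a4] by k, so a suitable k makes it 0 or 1. *)
  have [k [b [k0 kb fam]]] : exists k b, [/\ k != 0, b = a4 * k &
      exists j, evo_family i j (nform 1 0 b 0)].
    have [a4_0 | a4_0] := eqVneq a4 0.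
      exists 1, 0; rewrite a4_0 mul0r; split=> //.
      by exists 1%N; rewrite -E1_nform; constructor.
    exists (a4^-1), 1; rewrite invr_eq0 divff //; split=> //.
    by exists 2%N; rewrite -E2_nform; constructor.
  have [j fam_j] := fam; exists j, (nform 1 0 b 0); split=> //.
  have [r r2] := closed_sqrt (k * (a2 ^+ 2 + a3 ^+ 2)).
  have r0 : r != 0 by rewrite -sqrf_eq0 r2 mulf_neq0.
  apply/nform_isomorphicP => //.
  (* A rotation up to scale that carries the anisotropic vector (a2, a3) onto the axis of e2. *)
  exists r, (a2 * k), (- (a3 * k)), (a3 * k), (a2 * k); split; split=> //.
  - rewrite (_ : _ + _ = k ^+ 2 * (a2 ^+ 2 + a3 ^+ 2)); last by ring.
    by rewrite mulf_neq0 ?expf_neq0.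
  - by ring.
  - by ring.
  - by ring.
  - by ring.
  - by rewrite r2; ring.
  - by ring.
  - by rewrite r2 kb; ring.
(* An isotropic (a2, a3) is proportional to (1, i) or (1, -i); the sign [eps] is removed by taking q
   = eps k. *)
have [eps [eps2 a3E]] : exists eps, eps ^+ 2 = 1 /\ a3 = eps * (i * a2).
  have /eqP : a3 ^+ 2 = (i * a2) ^+ 2.
    rewrite exprMn i2 mulN1r; apply/eqP; rewrite -subr_eq0 opprK addrC.
    exact/eqP.
  rewrite eqf_sqr => /orP[] /eqP ->; [exists 1 | exists (-1)];
    by rewrite ?mul1r ?mulN1r ?sqrrN expr1n.
have a2_0 : a2 != 0.
  by apply: contraTneq a0 => a2_0; rewrite a3E a2_0 !mulr0 eqxx.
have [k [b [k0 kb fam]]] : exists k b, [/\ k != 0, a2 * b = a4 * k &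
    exists j, evo_family i j (nform 1 i b 0)].
  have [a4_0 | a4_0] := eqVneq a4 0.
    exists 1, 0; rewrite a4_0 mul0r mulr0; split=> //.
    by exists 3%N; rewrite -E3_nform; constructor.
  exists (a2 / a4), 1; rewrite mulf_neq0 ?invr_eq0 //; split=> //; first by field.
  by exists 4%N; rewrite -E4_nform; constructor.
have [j fam_j] := fam; exists j, (nform 1 i b 0); split=> //.
have [r r2] := closed_sqrt (a2 * k).
have r0 : r != 0 by rewrite -sqrf_eq0 r2 mulf_neq0.
apply: (nform_scale (r := r) (p := k) (q := eps * k)) => //.
- by rewrite exprMn eps2 mul1r.
- by rewrite mul0r.
- by rewrite r2 mulr1.
- rewrite r2 a3E; transitivity (a2 * k * i * eps ^+ 2); last by ring.
  by rewrite eps2 mulr1.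
by rewrite r2 mulrAC kb; ring.
Qed.

End Classification.

(** * Invariants of normal forms under isomorphism *)

Section Invariants.
Variables (F : fieldType) (a2 a3 a4 d b2 b3 b4 d' r p2 p3 q2 q3 : F).
Hypothesis T : nform_transform a2 a3 a4 d b2 b3 b4 d' r p2 p3 q2 q3.

(** With [d'] nonzero, f(e2) f(e3) = 0 also gives p3 q3 = 0; orthogonality and equal nonzero norms
    then leave only diagonal and antidiagonal matrices. *)
Lemma nform_transform_diag : d' != 0 ->
  [/\ p3 = 0, q2 = 0, p2 != 0 & q3 != 0] \/
  [/\ p2 = 0, q3 = 0, p3 != 0 & q2 != 0].
Proof.
move=> d'0; have [[_ s0 eqs dot0] [eod _ _ _ _]] := T; move: eod => /eqP.
rewrite !mulf_eq0 (negPf d'0) orbF => /orP[] /eqP z; move: s0 eqs dot0.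
  rewrite z mul0r expr0n /= !addr0 sqrf_eq0 => p2_0 eqs.
  move=> /eqP; rewrite mulf_eq0 (negPf p2_0) /= => /eqP q2_0.
  left; split=> //; rewrite -sqrf_eq0.
  by move: eqs; rewrite q2_0 expr0n add0r => ->; rewrite sqrf_eq0.
rewrite z mulr0 expr0n /= !addr0 => s0 eqs.
have q2_0 : q2 != 0 by rewrite -sqrf_eq0 eqs.
move=> /eqP; rewrite mulf_eq0 (negPf q2_0) orbF => /eqP p2_0.
by right; split=> //; move: s0; rewrite p2_0 expr0n add0r sqrf_eq0.
Qed.

Lemma nform_transform_d_eq0 : (d == 0) = (d' == 0).
Proof.
have [[_ s0 _ _] [_ ed _ _ _]] := T; have s20 := expf_neq0 2 s0.
have [d'0 | d'0] := eqVneq d' 0.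
  move: ed; rewrite d'0 !mulr0 add0r => /esym/eqP.
  by rewrite mulf_eq0 (negPf s20) orbF.
apply: contraTF isT => /eqP d0; move: ed; rewrite d0 mul0r addr0.
have [[-> _ _ q30] | [_ -> p30 _]] := nform_transform_diag d'0.
  by rewrite expr0n mul0r => /eqP; rewrite mulf_eq0 sqrf_eq0 (negPf q30) (negPf d'0).
rewrite expr0n mul0r => /esym/eqP.
by rewrite mulf_eq0 sqrf_eq0 (negPf p30) (negPf d'0).
Qed.

Lemma nform_transform_a4_eq0 : (a4 == 0) = (b4 == 0).
Proof.
have [[r0 s0 _ _] [_ _ _ _ eb4]] := T; have r20 := expf_neq0 2 r0.
move/(congr1 (eq_op^~ 0)): eb4; move: (r ^+ 2) (p2 ^+ 2 + p3 ^+ 2) r20 s0 => x s r20 s0.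
by rewrite !mulf_eq0 (negPf s0) (negPf r20) orbF.
Qed.

(** A similitude multiplies the form x^2 + y^2 by s, so the two norms differ by the nonzero factor s
    / r^4. *)
Lemma nform_transform_norm_eq0 :
  (a2 ^+ 2 + a3 ^+ 2 == 0) = (b2 ^+ 2 + b3 ^+ 2 == 0).
Proof.
have [[r0 s0 eqs dot0] [_ _ eb2 eb3 _]] := T; have r20 := expf_neq0 4 r0.
have /(congr1 (eq_op^~ 0)) : r ^+ 4 * (b2 ^+ 2 + b3 ^+ 2) =
    (p2 ^+ 2 + p3 ^+ 2) * (a2 ^+ 2 + a3 ^+ 2).
  transitivity ((r ^+ 2 * b2) ^+ 2 + (r ^+ 2 * b3) ^+ 2); first by ring.
  rewrite eb2 eb3; transitivity (a2 ^+ 2 * (p2 ^+ 2 + p3 ^+ 2)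
    + a3 ^+ 2 * (q2 ^+ 2 + q3 ^+ 2) + 2 * a2 * a3 * (p2 * q2 + p3 * q3)).
    by ring.
  by rewrite eqs dot0; ring.
by rewrite mulf_eq0 (negPf r20) mulf_eq0 (negPf s0).
Qed.

Lemma nform_transform_mul_eq0 : d' != 0 -> (a2 * a3 == 0) = (b2 * b3 == 0).
Proof.
move=> d'0; have [[r0 _ _ _] [_ _ eb2 eb3 _]] := T; have r20 := expf_neq0 2 r0.
move: (congr1 (eq_op^~ 0) eb2) (congr1 (eq_op^~ 0) eb3).
move: (r ^+ 2) r20 => x r20.
have [[-> -> p20 q30] | [-> -> p30 q20]] := nform_transform_diag d'0.
  rewrite !mulr0 addr0 add0r !mulf_eq0 (negPf p20) (negPf q30) (negPf r20).
  by rewrite /= !orbF => -> ->.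
rewrite !mulr0 addr0 add0r !mulf_eq0 (negPf p30) (negPf q20) (negPf r20).
by rewrite /= !orbF orbC => -> ->.
Qed.

End Invariants.

(** With d = d' = 1, comparing the e5-parts of f(e3)^2 with the norm equation gives s = s^2 in the
    diagonal case and s + s^2 = 0 in the antidiagonal one, so s is 1 or -1. *)
Lemma nform_transform_unit (F : fieldType) (a2 a3 a4 b2 b3 b4 r p2 p3 q2 q3 : F) :
    nform_transform a2 a3 a4 1 b2 b3 b4 1 r p2 p3 q2 q3 ->
  [/\ p2 ^+ 2 = 1, q3 ^+ 2 = 1, r ^+ 2 * b2 = a2 * p2, r ^+ 2 * b3 = a3 * q3 &
      r ^+ 2 * b4 = a4] \/
  [/\ p3 ^+ 2 = -1, q2 ^+ 2 = -1, r ^+ 2 * b2 = a3 * q2, r ^+ 2 * b3 = a2 * p3 &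
      r ^+ 2 * b4 = - a4].
Proof.
move=> T; have [[_ _ eqs _] [_ ed eb2 eb3 eb4]] := T.
move: eqs ed eb2 eb3 eb4.
have [[-> -> p20 _] | [-> -> p30 _]] := nform_transform_diag T (oner_neq0 F);
  rewrite ?expr0n /= !(mulr0, mul0r, add0r, addr0, mul1r, mulr1).
  move=> -> ed -> -> ->; have p2_1 : p2 ^+ 2 = 1.
    by apply: (mulfI (expf_neq0 2 p20)); rewrite -expr2 -ed mulr1.
  by left; rewrite p2_1 mulr1.
move=> -> ed -> -> ->; have p3_1 : p3 ^+ 2 = -1.
  apply: (mulfI (expf_neq0 2 p30)); rewrite mulrN1 -expr2; apply/eqP.
  by rewrite -addr_eq0 addrC -ed.
by right; rewrite p3_1 mulrN1.
Qed.

(** * Separation of the families and of their parameters *)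

Section IsomorphismClasses.
Variables (F : closedFieldType) (i : F).
Hypothesis i2 : i ^+ 2 = -1.

(** Built only from zero tests that isomorphisms preserve; a2 a3 is tested only for nonzero [d],
    where rotations mixing e2 and e3 are excluded. *)
Definition nform_index (a2 a3 a4 d : F) : nat :=
  if d != 0 then if a2 * a3 == 0 then 5 else 6 else
  if a2 ^+ 2 + a3 ^+ 2 == 0 then if a4 == 0 then 3 else 4 else
  if a4 == 0 then 1 else 2.

Lemma family_nform_index k (A : algebra F) : evo_family i k A ->
  exists a2 a3 a4 d, [/\ A = nform a2 a3 a4 d, (a2 != 0) || (a3 != 0) &
    k = nform_index a2 a3 a4 d].
Proof.
have n1 := oner_neq0 F; case=> [||||alpha|beta gamma beta0].
- exists 1, 0, 0, 0; rewrite E1_nform n1 /nform_index eqxx /= expr0n addr0.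
  by rewrite expr1n (negPf n1).
- exists 1, 0, 1, 0; rewrite E2_nform n1 /nform_index eqxx /= expr0n addr0.
  by rewrite expr1n (negPf n1).
- exists 1, i, 0, 0; rewrite E3_nform n1 /nform_index eqxx /= i2 expr1n.
  by rewrite subrr eqxx.
- exists 1, i, 1, 0; rewrite E4_nform n1 /nform_index eqxx /= i2 expr1n.
  by rewrite subrr eqxx (negPf n1).
- by exists 1, 0, alpha, 1; rewrite E5_nform /nform_index n1 mulr0 eqxx.
exists beta, 1, gamma, 1; rewrite E6_nform /nform_index n1 orbT mulr1.
by rewrite (negPf beta0).
Qed.

Lemma family_isomorphic k l (A B : algebra F) :
  evo_family i k A -> evo_family i l B -> isomorphic A B -> k = l.
Proof.
move=> /family_nform_index[a2 [a3 [a4 [d [-> a0 ->]]]]].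
move=> /family_nform_index[b2 [b3 [b4 [d' [-> b0 ->]]]]].
move=> /nform_isomorphicP[] // r [p2 [p3 [q2 [q3 T]]]].
rewrite /nform_index (nform_transform_d_eq0 T) (nform_transform_a4_eq0 T).
rewrite (nform_transform_norm_eq0 T).
by case: (eqVneq d' 0) => //= /(nform_transform_mul_eq0 T) ->.
Qed.

Lemma sqr_eq1 (x : F) : x ^+ 2 = 1 -> x = 1 \/ x = -1.
Proof. by move/eqP; rewrite sqrf_eq1 => /orP[] /eqP; [left | right]. Qed.

Lemma E5_isomorphicP (alpha alpha' : F) :
  isomorphic (E5 alpha) (E5 alpha') <-> alpha' = alpha \/ alpha' = - alpha.
Proof.
have n1 := oner_neq0 F; have n10 : (1 != 0 :> F) || (0 != 0 :> F) by rewrite n1.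
rewrite !E5_nform; split.
  case/nform_isomorphicP=> // r [p2 [p3 [q2 [q3 T]]]]; have [[r0 _ _ _] _] := T.
  have [[p22 _] | [_ _]] := nform_transform_unit T; rewrite mulr1 mul0r.
    move=> r2 _ eb4; have -> : alpha' = p2 * alpha.
      by rewrite -eb4 r2 mul1r mulrA -expr2 p22 mul1r.
    by case: (sqr_eq1 p22) => ->; rewrite ?mul1r ?mulN1r; [left | right].
  (* The exchange is impossible here: it would send the e3-coefficient 0 of e1^2 to the
     e2-coefficient 1. *)
  by move=> /eqP; rewrite sqrf_eq0 (negPf r0).
have i0 : i != 0 by rewrite -sqrf_eq0 i2 oppr_eq0.
case=> ->.
  by apply: (nform_scale (r := 1) (p := 1) (q := 1)) => //; ring.
(* With r^2 = -1 the choice p = -1 keeps the coefficient of e2, while [alpha] changes sign. *)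
apply: (nform_scale (r := i) (p := (-1)) (q := 1)) => //; rewrite ?oppr_eq0 ?i2 //;
  by ring.
Qed.

(** Diagonal similitudes give the first alternative, the exchange of e2 and e3 the second. *)
Lemma E6_isomorphicP (beta gamma beta' gamma' : F) : beta != 0 -> beta' != 0 ->
  isomorphic (E6 beta gamma) (E6 beta' gamma') <->
  ((beta' = beta \/ beta' = - beta) /\ (gamma' = gamma \/ gamma' = - gamma)) \/
  ((beta * beta' = 1 \/ beta * beta' = -1) /\
   (gamma' = i * beta^-1 * gamma \/ gamma' = - (i * beta^-1 * gamma))).
Proof.
move=> b0 b0'; have n1 := oner_neq0 F.
have i0 : i != 0 by rewrite -sqrf_eq0 i2 oppr_eq0.
have sgn (x y : F) : (x = y \/ x = - y) <-> exists2 eps, eps ^+ 2 = 1 & x = eps * y.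
  split=> [[] -> | [eps eps2 ->]].
  - by exists 1; rewrite ?expr1n ?mul1r.
  - by exists (-1); rewrite ?sqrrN ?expr1n ?mulN1r.
  by case: (sqr_eq1 eps2) => ->; rewrite ?mul1r ?mulN1r; [left | right].
rewrite !sgn !E6_nform; split.
  case/nform_isomorphicP=> [||r [p2 [p3 [q2 [q3 T]]]]]; rewrite ?b0 ?b0' //.
  (* The e3-coefficient of e1^2 is 1 on both sides, which determines r^2: it is q3 in the diagonal
     case and beta p3 in the other. *)
  have [[p22 q32 + + +] | [p32 q22 + + +]] := nform_transform_unit T;
    rewrite mulr1 => eb2 eb3; rewrite ?mul1r in eb2 eb3; rewrite eb3 in eb2 * => eb4.
    left; split.
      exists (p2 * q3); first by rewrite exprMn p22 q32 mulr1.
      rewrite -[LHS]mul1r -q32; transitivity (q3 * (q3 * beta')); first by ring.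
      by rewrite eb2; ring.
    by exists q3 => //; rewrite -eb4 mulrA -expr2 q32 mul1r.
  have p30 : p3 != 0 by rewrite -sqrf_eq0 p32 oppr_eq0.
  right; split.
    exists (- (q2 * p3)); first by rewrite sqrrN exprMn p32 q22 mulrNN mulr1.
    rewrite mulr1 -[LHS]mul1r -[X in X * _]opprK -p32 -eb2.
    by ring.
  exists (- (i * p3)); first by rewrite sqrrN exprMn i2 p32 mulrNN mulr1.
  apply: (mulfI b0); apply: (mulfI p30); rewrite -(opprK gamma) -eb4.
  transitivity (- (i ^+ 2) * - (p3 ^+ 2) * (beta * p3 * gamma')).
    by rewrite i2 p32; ring.
  by field.
move=> [[[eps eps2 ->] [dlt dlt2 ->]] | [[eps eps2 bb] [dlt dlt2 ->]]].
  have [r r2] := closed_sqrt dlt.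
  have dlt0 : dlt != 0 by rewrite -sqrf_eq0 dlt2.
  have eps0 : eps != 0 by rewrite -sqrf_eq0 eps2.
  apply: (nform_scale (r := r) (p := eps * dlt) (q := dlt));
    rewrite ?n1 ?b0 ?b0' ?mulf_neq0 ?exprMn ?eps2 ?dlt2 ?r2 ?mul1r ?mulr1 //.
  - by rewrite -sqrf_eq0 r2.
  - by ring.
  by rewrite mulrA -expr2 dlt2 mul1r.
(* The exchange needs p^2 = -1 to keep d = 1, hence p = dlt i, and r^2 = beta p keeps the
   e3-coefficient equal to 1. *)
have [r r2] := closed_sqrt (beta * (dlt * i)).
have dlt0 : dlt != 0 by rewrite -sqrf_eq0 dlt2.
have di2 : (dlt * i) ^+ 2 = -1 by rewrite exprMn dlt2 i2 mul1r.
apply: (nform_swap (r := r) (p := dlt * i) (q := eps * (dlt * i)));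
  rewrite ?n1 ?b0 ?b0' ?mulf_neq0 // ?di2 ?r2.
- by rewrite -sqrf_eq0 r2 !mulf_neq0.
- by rewrite exprMn eps2 mul1r di2.
- by ring.
- by transitivity (beta * beta' * (dlt * i)); [ring | rewrite bb; ring].
- by ring.
transitivity (gamma * (dlt * i) ^+ 2); first by field.
by rewrite di2.
Qed.

End IsomorphismClasses.

Theorem theorem6p7 (F : closedFieldType) (char_neq2 : 2%N \notin [pchar F])
    (i : F) (i2 : i ^+ 2 = -1) :
  [/\ forall E : algebra F,
        evolution_algebra E -> nilpotent E -> has_type E [:: 1; 1; 2; 1]%N ->
        exists k (B : algebra F), evo_family i k B /\ isomorphic E B,
      forall (k l : nat) (A B : algebra F),
        evo_family i k A -> evo_family i l B -> k <> l -> ~ isomorphic A B,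
      forall alpha alpha' : F,
        isomorphic (E5 alpha) (E5 alpha') <->
        alpha' = alpha \/ alpha' = - alpha
    & forall beta gamma beta' gamma' : F, beta != 0 -> beta' != 0 ->
        isomorphic (E6 beta gamma) (E6 beta' gamma') <->
        ((beta' = beta \/ beta' = - beta) /\
         (gamma' = gamma \/ gamma' = - gamma)) \/
        ((beta * beta' = 1 \/ beta * beta' = -1) /\
         (gamma' = i * beta^-1 * gamma \/ gamma' = - (i * beta^-1 * gamma)))].
Proof.
split.
- move=> E E_evo _ /(type1121_tri E_evo).
  move=> [a2 [a3 [a4 [a5 [b4 [b5 [c4 [c5 [d5 [[a0 b0 c0 d0] E_tri]]]]]]]]]].
  have [a2' [a3' [a4' [d [a0' tri_nf]]]]] := tri_nform a4 a5 b5 c5 a0 b0 c0 d0.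
  have [k [B [famB nf_B]]] := nform_family i2 a4' d a0'.
  exists k, B; split=> //.
  exact: isomorphic_trans E_tri (isomorphic_trans tri_nf nf_B).
- move=> k l A B famA famB ne_kl isoAB; apply: ne_kl.
  exact: (family_isomorphic i2 famA famB isoAB).
- exact: E5_isomorphicP i2.
exact: E6_isomorphicP i2.
Qed.
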